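(* Fix $\lambda>0$ and let $\phi:\mathbb R\to\mathbb R$ be Lipschitz with lower bound $l_\phi\ge0$ (i.e. $\phi\ge l_\phi$). Then there exists a solution $V^{\lambda,\phi}$ of $$(\mathcal L-r)v+f-\lambda e^{-(\phi-v)/\lambda}=0\quad\text{on }\mathbb R$$ such that $V^{\lambda,\phi}\in\mathcal C^{2,\alpha}_{loc}(\mathbb R)$ for every $\alpha\in(0,1)$ and $\limsup_{|x|\to\infty}|V^{\lambda,\phi}(x)/x|<\infty$.
   Context: Standing assumptions: $b,\sigma:\mathbb R\to\mathbb R$ with $|b(x)-b(y)|+|\sigma(x)-\sigma(y)|\le L|x-y|$ for some $L>0$, and $|\sigma(x)|\ge\sigma_0>0$; $f:\mathbb R\to[0,\infty)$, $f(0)=0$, $f$ is $L_f$-Lipschitz; $l:\mathbb R\to\mathbb R$ satisfies: there is $K>0$ with $\inf l=l(0)=K$ and $l(x)+l(y)\ge l(x+y)+K$, $l(\xi)\to\infty$ as $|\xi|\to\infty$, $l$ is $L_l$-Lipschitz; with $G=L+\frac12L^2$, the discount rate satisfies $0<r-G<L_f/L_l$. $\mathcal L v=bv'+\frac12\sigma^2v''$. $\mathcal C^{2,\alpha}_{loc}(\mathbb R)$ is the space of functions whose restriction to every bounded open set is $\mathcal C^2$ with $\alpha$-Hölder continuous second derivative. *)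

(* Defs.v *)
From Stdlib Require Import Reals Lra.
From Coquelicot Require Import Coquelicot.
Open Scope R_scope.

Definition lipschitz_with (C : R) (g : R -> R) : Prop :=
  forall x y, Rabs (g x - g y) <= C * Rabs (x - y).

Definition lipschitz (g : R -> R) : Prop := exists C, lipschitz_with C g.

Definition twice_deriv (V V1 V2 : R -> R) : Prop :=
  forall x, is_derive V x (V1 x) /\ is_derive V1 x (V2 x).

Definition holder_loc (alpha : R) (g : R -> R) : Prop :=
  forall M, exists H, 0 <= H /\
    forall x y, Rabs x <= M -> Rabs y <= M -> x <> y ->
      Rabs (g x - g y) <= H * Rpower (Rabs (x - y)) alpha.

Definition C2alpha_loc (alpha : R) (V : R -> R) : Prop :=
  exists V1 V2, twice_deriv V V1 V2 /\ holder_loc alpha V2.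

Definition linear_growth_at_infinity (V : R -> R) : Prop :=
  exists C M, forall x, M <= Rabs x -> Rabs (V x / x) <= C.

Definition coercive (l : R -> R) : Prop :=
  forall A, exists M, forall xi, M <= Rabs xi -> A <= l xi.

Definition solves_eq (b sigma f phi : R -> R) (r lambda : R) (V : R -> R) : Prop :=
  exists V1 V2, twice_deriv V V1 V2 /\
    forall x, b x * V1 x + / 2 * (sigma x) ^ 2 * V2 x - r * V x + f x
              - lambda * exp (- (phi x - V x) / lambda) = 0.

(* Main.v *)
Require Import Defs.
From Stdlib Require Import Reals Lra Lia IndefiniteDescription.
From Coquelicot Require Import Coquelicot.
Open Scope R_scope.

(** A large negative constant is a strict subsolution and [A * sqrt (1 + x^2) + D]
    a strict supersolution, since the drift grows at most like [L * |x|] and [L < r].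
    Clamping the unknown between these barriers makes the nonlinearity bounded and
    Lipschitz, locally uniformly in [x], so that initial value problems have global
    solutions depending continuously on the data (Picard iteration in a weighted
    sup norm).  Shooting solves the Dirichlet problem on [-n <= x <= n], and the maximum
    principle keeps the solution between the barriers, where the clamp is invisible.
    The Cauchy data at 0 stay bounded in [n]; a cluster point of them generates an
    entire solution between the barriers.  Its second derivative, given by the
    equation, is locally Lipschitz. *)

(** The exponential term grows without bound in the unknown, so unclamped initial value problems
    could blow up. After clamping, the drift would still put [V'] on the right-hand side. The
    integrating factor [E = exp (RInt beta 0 x)] removes it: with [m = E * V'] the equation reads
    [u' = a m], [m' = h(x, u)], where [a = 1 / E] and [|h|] is bounded by a function of [x] alone.
    The variation of [m] on a compact interval is therefore bounded independently of the solution;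
    this yields both the range of slopes for the shooting and the bound on the slope at 0. A single
    continuous [kappa] dominates [a], [h] and the Lipschitz constant of [h]. It may be unbounded on
    the line; a weight built from its primitive compensates for this, so one contraction argument
    works on the whole line at once. Strictness of the barriers decides the comparison: at a
    critical point beyond a barrier the clamp freezes the nonlinearity at the barrier value, which
    fixes the sign of the second derivative. *)

Lemma is_derive_continuity_pt (f : R -> R) (x l : R) :
  is_derive f x l -> continuity_pt f x.
Proof.
  intros Hf. apply continuity_pt_filterlim, (ex_derive_continuous f).
  now exists l.
Qed.

Lemma is_derive_RInt_continuous (g : R -> R) (x0 x : R) :
  (forall y, continuous g y) -> is_derive (fun y => RInt g x0 y) x (g x).
Proof.
  intros Hg. apply (is_derive_RInt g _ x0); [|apply Hg].
  apply filter_forall. intros y. apply (@RInt_correct R_CompleteNormedModule).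
  apply ex_RInt_continuous. intros z _. apply Hg.
Qed.

Lemma MVT_is_derive (f df : R -> R) (a b : R) :
  (forall x, is_derive f x (df x)) ->
  exists c, Rmin a b <= c <= Rmax a b /\ f b - f a = df c * (b - a).
Proof.
  intros Hf. apply MVT_gen; intros x _; [apply Hf|].
  exact (is_derive_continuity_pt f x _ (Hf x)).
Qed.

(* [auto_derive] leaves the derivative of an abstract function eta-expanded. *)
Ltac rewrite_derive f x H :=
  change (Derive (fun y => f y) x) with (Derive f x);
  rewrite (is_derive_unique f x _ H).

(** * Weighted bounds for primitives *)

Section Weight.
Variables (kappa : R -> R) (x0 : R).
Hypothesis kappa_cont : forall x, continuous kappa x.

(** This is [2 cosh (2 K)] with [K = RInt kappa x0 x]: a smooth replacement for [exp (2 |K|)] that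
    serves both sides of [x0]. The inner factor 2 is the source of the gain 1/2 per integration. *)
Definition weight (x : R) : R :=
  exp (2 * RInt kappa x0 x) + exp (- (2 * RInt kappa x0 x)).

(** This is [2 sinh (2 K)]; half of it is the primitive of [kappa * weight] that vanishes at
    [x0]. *)
Definition odd_weight (x : R) : R :=
  exp (2 * RInt kappa x0 x) - exp (- (2 * RInt kappa x0 x)).

Lemma is_derive_weight (x : R) :
  is_derive weight x (2 * kappa x * odd_weight x).
Proof.
  unfold weight, odd_weight. set (k := (fun y => RInt kappa x0 y) : R -> R).
  assert (H : is_derive k x (kappa x)) by now apply is_derive_RInt_continuous. clearbody k.
  change (is_derive (fun y => exp (2 * k y) + exp (- (2 * k y))) x
    (2 * kappa x * (exp (2 * k x) - exp (- (2 * k x))))).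
  auto_derive; [repeat split; now exists (kappa x)|].
  rewrite_derive k x H. ring.
Qed.

Lemma is_derive_odd_weight (x : R) :
  is_derive odd_weight x (2 * kappa x * weight x).
Proof.
  unfold weight, odd_weight. set (k := (fun y => RInt kappa x0 y) : R -> R).
  assert (H : is_derive k x (kappa x)) by now apply is_derive_RInt_continuous. clearbody k.
  change (is_derive (fun y => exp (2 * k y) - exp (- (2 * k y))) x
    (2 * kappa x * (exp (2 * k x) + exp (- (2 * k x))))).
  auto_derive; [repeat split; now exists (kappa x)|].
  rewrite_derive k x H. ring.
Qed.

Lemma weight_ge1 (x : R) : 1 <= weight x.
Proof.
  unfold weight. set (t := 2 * RInt kappa x0 x).
  pose proof (exp_pos t). pose proof (exp_pos (- t)).
  destruct (Rle_dec 0 t) as [h|h].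
  - pose proof (exp_ineq1_le t). lra.
  - pose proof (exp_ineq1_le (- t)). lra.
Qed.

Lemma abs_odd_weight_le (x : R) : Rabs (odd_weight x) <= weight x.
Proof.
  unfold odd_weight, weight. set (t := 2 * RInt kappa x0 x).
  pose proof (exp_pos t). pose proof (exp_pos (- t)).
  apply Rabs_le. lra.
Qed.

Lemma odd_weight_base : odd_weight x0 = 0.
Proof.
  unfold odd_weight. rewrite RInt_point. unfold zero; simpl.
  rewrite Rmult_0_r, Ropp_0. ring.
Qed.

(** The primitive of [c * kappa * weight] is [c / 2 * odd_weight], itself at most [c / 2 * weight]
    in absolute value. The bound on [g] is asked only on the ball reaching to [x], so that it may
    come from a maximum over a compact set. *)
Lemma weight_primitive_bound (F g : R -> R) (c x : R) :
  0 <= c ->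
  (forall y, is_derive F y (g y)) -> F x0 = 0 ->
  (forall y, Rabs (y - x0) <= Rabs (x - x0) -> Rabs (g y) <= c * (kappa y * weight y)) ->
  Rabs (F x) <= c / 2 * weight x.
Proof.
  intros Hc HF HF0 Hg.
  assert (Hbetween : forall y, Rmin x0 x <= y <= Rmax x0 x ->
                     Rabs (y - x0) <= Rabs (x - x0)).
  { intros y. unfold Rmin, Rmax.
    destruct (Rle_dec x0 x) as [h|h]; intros Hy;
      unfold Rabs; repeat destruct Rcase_abs; lra. }
  (* Adding or subtracting [F] gives two functions that vanish at [x0] and have nonnegative
     derivative between [x0] and [x]; each therefore has the sign of [x - x0]. *)
  destruct (MVT_is_derive (fun y => c / 2 * odd_weight y + F y)
              (fun y => c / 2 * (2 * kappa y * weight y) + g y) x0 x) as [y1 [Hy1 E1]].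
  { intros y. apply (@is_derive_plus R_AbsRing R_NormedModule); [|apply HF].
    apply (is_derive_scal odd_weight), is_derive_odd_weight. }
  destruct (MVT_is_derive (fun y => c / 2 * odd_weight y - F y)
              (fun y => c / 2 * (2 * kappa y * weight y) - g y) x0 x) as [y2 [Hy2 E2]].
  { intros y. apply (@is_derive_minus R_AbsRing R_NormedModule); [|apply HF].
    apply (is_derive_scal odd_weight), is_derive_odd_weight. }
  rewrite odd_weight_base, HF0 in E1, E2.
  pose proof (Rabs_le_between (g y1) (c * (kappa y1 * weight y1))) as [B1 _].
  specialize (B1 (Hg _ (Hbetween _ Hy1))).
  pose proof (Rabs_le_between (g y2) (c * (kappa y2 * weight y2))) as [B2 _].
  specialize (B2 (Hg _ (Hbetween _ Hy2))).
  pose proof (abs_odd_weight_le x) as Hodd.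
  apply Rabs_le_between in Hodd.
  apply Rabs_le.
  destruct (Rle_dec x0 x) as [h|h].
  - assert (0 <= c / 2 * odd_weight x + F x) by nra.
    assert (0 <= c / 2 * odd_weight x - F x) by nra.
    nra.
  - assert (c / 2 * odd_weight x + F x <= 0) by nra.
    assert (c / 2 * odd_weight x - F x <= 0) by nra.
    nra.
Qed.

End Weight.

(** * Cluster points of bounded real data *)

Lemma real_sequence_cluster (x : nat -> R) (lo hi : R) :
  (forall n, lo <= x n <= hi) ->
  exists l, forall eps N, 0 < eps -> exists n, (N <= n)%nat /\ Rabs (x n - l) < eps.
Proof.
  intros Hx.
  destruct (Bolzano_Weierstrass x (fun c => lo <= c <= hi) (compact_P3 lo hi) Hx) as [l Hl].
  exists l. intros eps N Heps.
  destruct (Hl (fun y => Rabs (y - l) < eps) N) as [n [Hn Hd]]; [|now exists n].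
  exists (mkposreal eps Heps). intros y Hy. exact Hy.
Qed.

Lemma real_pair_cluster (S : nat -> R -> R -> Prop) (lo1 hi1 lo2 hi2 : R) :
  (forall n, exists x y, S n x y /\ lo1 <= x <= hi1 /\ lo2 <= y <= hi2) ->
  exists x y, forall eps N, 0 < eps ->
    exists n x' y', (N <= n)%nat /\ S n x' y' /\ Rabs (x' - x) < eps /\ Rabs (y' - y) < eps.
Proof.
  intros HS.
  assert (HS' : forall n, exists z : R * R,
    S n (fst z) (snd z) /\ lo1 <= fst z <= hi1 /\ lo2 <= snd z <= hi2).
  { intros n. destruct (HS n) as [x [y H]]. now exists (x, y). }
  apply functional_choice in HS'. destruct HS' as [z Hz].
  destruct (real_sequence_cluster (fun n => fst (z n)) lo1 hi1) as [x Hx];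
    [intros n; apply Hz|].
  (* Along [phi] the first coordinate converges at rate [1 / (k + 1)], so it stays close for
     whatever large [k] the second coordinate selects. *)
  assert (Hsub : forall k : nat, exists n,
            (k <= n)%nat /\ Rabs (fst (z n) - x) < / (INR k + 1)).
  { intros k. apply Hx, Rinv_0_lt_compat. pose proof (pos_INR k). lra. }
  apply functional_choice in Hsub. destruct Hsub as [phi Hphi].
  destruct (real_sequence_cluster (fun k => snd (z (phi k))) lo2 hi2) as [y Hy];
    [intros k; apply Hz|].
  exists x, y. intros eps N Heps.
  destruct (nfloor_ex (/ eps)) as [K HK]; [left; now apply Rinv_0_lt_compat|].
  destruct (Hy eps (N + K)%nat Heps) as [k [Hk Hyk]].
  destruct (Hphi k) as [Hle Hxk].
  exists (phi k), (fst (z (phi k))), (snd (z (phi k))).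
  split; [lia|]. split; [apply Hz|]. split; [|exact Hyk].
  eapply Rlt_le_trans; [exact Hxk|].
  rewrite <- (Rinv_inv eps). apply Rinv_le_contravar; [now apply Rinv_0_lt_compat|].
  assert (INR K <= INR k) by (apply le_INR; lia). lra.
Qed.

(** * The first-order system u' = a m, m' = h(x, u) *)

Section System.
Variables (a kappa : R -> R) (h : R -> R -> R).
Hypothesis a_cont : forall x, continuous a x.
Hypothesis kappa_cont : forall x, continuous kappa x.
Hypothesis a_bound : forall x, Rabs (a x) <= kappa x.
Hypothesis h_bound : forall x u, Rabs (h x u) <= kappa x.
Hypothesis h_lip : forall x u v, Rabs (h x u - h x v) <= kappa x * Rabs (u - v).
Hypothesis h_cont : forall u, (forall x, continuous u x) ->
  forall x, continuous (fun z => h z (u z)) x.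

Definition solution (x0 A P : R) (u m : R -> R) : Prop :=
  (forall x, is_derive u x (a x * m x)) /\
  (forall x, is_derive m x (h x (u x))) /\ u x0 = A /\ m x0 = P.

Lemma kappa_nonneg (x : R) : 0 <= kappa x.
Proof. pose proof (Rabs_pos (a x)). pose proof (a_bound x). lra. Qed.

(* Two integrations, each gaining a factor 1/2 in the weighted norm. *)
Lemma integration_step_bound (x0 A P d x : R) (v u m : R -> R) :
  0 <= d ->
  (forall y, is_derive u y (a y * m y)) -> (forall y, is_derive m y (v y)) ->
  u x0 = A -> m x0 = P ->
  (forall y, Rabs (y - x0) <= Rabs (x - x0) ->
    Rabs (v y) <= d * (kappa y * weight kappa x0 y)) ->
  Rabs (u x) <= (Rabs A + Rabs P + d / 4) * weight kappa x0 x.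
Proof.
  intros Hd Hu Hm HA HP Hv.
  (* Since [weight >= 1], the constant [P] is absorbed into the weighted bound. Multiplied by
     [|a| <= kappa], this bound has the form required for the second integration. *)
  assert (Hm2 : forall y, Rabs (y - x0) <= Rabs (x - x0) ->
            Rabs (m y) <= (Rabs P + d / 2) * weight kappa x0 y).
  { intros y Hy.
    assert (Rabs (m y - P) <= d / 2 * weight kappa x0 y).
    { apply (weight_primitive_bound kappa x0 kappa_cont
               (fun y => m y - P) v); [exact Hd| |rewrite HP; ring|].
      - intros z. auto_derive; [now exists (v z)|].
        rewrite_derive m z (Hm z). ring.
      - intros z Hz. apply Hv. lra. }
    pose proof (weight_ge1 kappa x0 y). pose proof (Rabs_pos P).
    replace (m y) with (P + (m y - P)) by ring.
    eapply Rle_trans; [apply Rabs_triang|]. nra. }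
  assert (Hu2 : Rabs (u x - A) <= (Rabs P + d / 2) / 2 * weight kappa x0 x).
  { pose proof (Rabs_pos P).
    apply (weight_primitive_bound kappa x0 kappa_cont
             (fun y => u y - A) (fun y => a y * m y));
      [lra| |rewrite HA; ring|].
    - intros z. auto_derive; [now exists (a z * m z)|].
      rewrite_derive u z (Hu z). ring.
    - intros z Hz. rewrite Rabs_mult.
      replace ((Rabs P + d / 2) * (kappa z * weight kappa x0 z))
        with (kappa z * ((Rabs P + d / 2) * weight kappa x0 z)) by ring.
      apply Rmult_le_compat; try apply Rabs_pos; auto. }
  pose proof (weight_ge1 kappa x0 x). pose proof (Rabs_pos P). pose proof (Rabs_pos A).
  replace (u x) with (A + (u x - A)) by ring.
  eapply Rle_trans; [apply Rabs_triang|]. nra.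
Qed.

Definition picard_slope (x0 P : R) (v : R -> R) (y : R) : R :=
  P + RInt (fun z => h z (v z)) x0 y.

Definition picard_map (x0 A P : R) (v : R -> R) (x : R) : R :=
  A + RInt (fun y => a y * picard_slope x0 P v y) x0 x.

Fixpoint picard (x0 A P : R) (k : nat) : R -> R :=
  match k with
  | O => fun _ => A
  | S k => picard_map x0 A P (picard x0 A P k)
  end.

Lemma is_derive_picard_slope (x0 P : R) (v : R -> R) (x : R) :
  (forall y, continuous v y) ->
  is_derive (picard_slope x0 P v) x (h x (v x)).
Proof.
  intros Hv. unfold picard_slope.
  set (k := (fun y => RInt (fun z => h z (v z)) x0 y) : R -> R).
  assert (H : is_derive k x (h x (v x))).
  { apply (is_derive_RInt_continuous (fun z => h z (v z))), h_cont, Hv. } clearbody k.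
  change (is_derive (fun y => P + k y) x (h x (v x))).
  auto_derive; [now exists (h x (v x))|].
  rewrite_derive k x H. ring.
Qed.

Lemma is_derive_picard_map (x0 A P : R) (v : R -> R) (x : R) :
  (forall y, continuous v y) ->
  is_derive (picard_map x0 A P v) x (a x * picard_slope x0 P v x).
Proof.
  intros Hv. unfold picard_map.
  assert (Hc : forall y, continuous (fun y => a y * picard_slope x0 P v y) y).
  { intros y. apply (continuous_mult a); [apply a_cont|].
    apply (ex_derive_continuous (picard_slope x0 P v)).
    eexists. now apply is_derive_picard_slope. }
  set (g := fun y => a y * picard_slope x0 P v y) in *.
  set (k := (fun y => RInt g x0 y) : R -> R).
  assert (H : is_derive k x (g x)) by now apply is_derive_RInt_continuous. clearbody k.
  change (is_derive (fun y => A + k y) x (g x)).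
  auto_derive; [now exists (g x)|].
  rewrite_derive k x H. ring.
Qed.

Lemma picard_slope_base (x0 P : R) (v : R -> R) : picard_slope x0 P v x0 = P.
Proof.
  unfold picard_slope. rewrite RInt_point. unfold zero; simpl. ring.
Qed.

Lemma picard_map_base (x0 A P : R) (v : R -> R) : picard_map x0 A P v x0 = A.
Proof.
  unfold picard_map. rewrite RInt_point. unfold zero; simpl. ring.
Qed.

Lemma picard_map_contract (x0 A P d x : R) (v1 v2 : R -> R) :
  0 <= d ->
  (forall y, continuous v1 y) -> (forall y, continuous v2 y) ->
  (forall y, Rabs (v1 y - v2 y) <= d * weight kappa x0 y) ->
  Rabs (picard_map x0 A P v1 x - picard_map x0 A P v2 x) <= d / 4 * weight kappa x0 x.
Proof.
  intros Hd H1 H2 H12.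
  replace (d / 4) with (Rabs 0 + Rabs 0 + d / 4) by (rewrite Rabs_R0; ring).
  apply (integration_step_bound x0 0 0 d x (fun y => h y (v1 y) - h y (v2 y))
    (fun y => picard_map x0 A P v1 y - picard_map x0 A P v2 y)
    (fun y => picard_slope x0 P v1 y - picard_slope x0 P v2 y)).
  - exact Hd.
  - intros y.
    replace (a y * (picard_slope x0 P v1 y - picard_slope x0 P v2 y))
      with (a y * picard_slope x0 P v1 y - a y * picard_slope x0 P v2 y) by ring.
    apply (@is_derive_minus R_AbsRing R_NormedModule); now apply is_derive_picard_map.
  - intros y.
    apply (@is_derive_minus R_AbsRing R_NormedModule); now apply is_derive_picard_slope.
  - rewrite !picard_map_base. ring.
  - rewrite !picard_slope_base. ring.
  - intros y _. eapply Rle_trans; [apply h_lip|].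
    replace (d * (kappa y * weight kappa x0 y))
      with (kappa y * (d * weight kappa x0 y)) by ring.
    apply Rmult_le_compat_l; [apply kappa_nonneg|apply H12].
Qed.

Lemma picard_continuous (x0 A P : R) (k : nat) (x : R) :
  continuous (picard x0 A P k) x.
Proof.
  revert x. induction k as [|k IH]; intros x; simpl.
  - apply continuous_const.
  - apply (ex_derive_continuous (picard_map x0 A P (picard x0 A P k))).
    eexists. now apply is_derive_picard_map.
Qed.

Lemma picard_step (x0 A P : R) (k : nat) (x : R) :
  Rabs (picard x0 A P (S k) x - picard x0 A P k x)
    <= (Rabs P + 1) * (/ 4) ^ k * weight kappa x0 x.
Proof.
  revert x. induction k as [|k IH]; intros x.
  - simpl. rewrite Rmult_1_r.
    pose proof (weight_ge1 kappa x0 x).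
    (* The first increment has [d = 1], because [|h y A| <= kappa y <= kappa y * weight]. This gives
       [|P| + 1 / 4], rounded up to [|P| + 1]. *)
    apply Rle_trans with ((Rabs 0 + Rabs P + 1 / 4) * weight kappa x0 x);
      [|rewrite Rabs_R0; nra].
    apply (integration_step_bound x0 0 P 1 x (fun y => h y A)
      (fun y => picard_map x0 A P (fun _ => A) y - A)
      (picard_slope x0 P (fun _ => A))).
    + lra.
    + intros y.
      assert (H1 : is_derive (picard_map x0 A P (fun _ => A)) y
                (a y * picard_slope x0 P (fun _ => A) y)).
      { apply is_derive_picard_map. intros z. apply continuous_const. }
      set (k := picard_map x0 A P (fun _ => A)) in *. clearbody k.
      auto_derive; [eexists; exact H1|]. rewrite_derive k y H1. ring.
    + intros y. apply (is_derive_picard_slope x0 P (fun _ => A)).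
      intros z. apply continuous_const.
    + rewrite picard_map_base. ring.
    + apply picard_slope_base.
    + intros y _. pose proof (h_bound y A). pose proof (weight_ge1 kappa x0 y).
      pose proof (kappa_nonneg y). nra.
  - change (picard x0 A P (S (S k))) with (picard_map x0 A P (picard x0 A P (S k))).
    change (picard x0 A P (S k) x) with (picard_map x0 A P (picard x0 A P k) x).
    replace ((Rabs P + 1) * (/ 4) ^ (S k))
      with ((Rabs P + 1) * (/ 4) ^ k / 4) by (simpl; field).
    apply picard_map_contract; auto using picard_continuous.
    apply Rmult_le_pos; [pose proof (Rabs_pos P); lra|apply pow_le; lra].
Qed.

Lemma picard_tail (x0 A P : R) (k j : nat) (x : R) :
  Rabs (picard x0 A P (k + j) x - picard x0 A P k x)
    <= 2 * (Rabs P + 1) * (/ 4) ^ k * weight kappa x0 x.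
Proof.
  (* The factor [4 / 3 = 1 / (1 - 1 / 4)] makes the geometric increments telescope exactly; it is
     rounded up to 2 afterwards. *)
  assert (H : Rabs (picard x0 A P (k + j) x - picard x0 A P k x)
    <= 4 / 3 * (Rabs P + 1) * weight kappa x0 x * ((/ 4) ^ k - (/ 4) ^ (k + j))).
  { induction j as [|j IH].
    - rewrite Nat.add_0_r, Rminus_diag, Rabs_R0. lra.
    - pose proof (picard_step x0 A P (k + j) x) as Hs.
      replace (k + S j)%nat with (S (k + j)) by lia.
      replace (picard x0 A P (S (k + j)) x - picard x0 A P k x)
        with ((picard x0 A P (S (k + j)) x - picard x0 A P (k + j) x)
              + (picard x0 A P (k + j) x - picard x0 A P k x)) by ring.
      eapply Rle_trans; [apply Rabs_triang|].
      replace ((/ 4) ^ S (k + j)) with ((/ 4) ^ (k + j) / 4) by (simpl; field).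
      lra. }
  eapply Rle_trans; [exact H|].
  pose proof (Rabs_pos P). pose proof (weight_ge1 kappa x0 x).
  pose proof (pow_le (/ 4) k ltac:(lra)). pose proof (pow_le (/ 4) (k + j) ltac:(lra)).
  assert (0 <= (Rabs P + 1) * weight kappa x0 x) by (apply Rmult_le_pos; lra).
  nra.
Qed.

Lemma pow_quarter_small (c eps : R) :
  0 <= c -> 0 < eps -> exists N, forall k, (N <= k)%nat -> c * (/ 4) ^ k < eps.
Proof.
  intros Hc He.
  destruct (pow_lt_1_zero (/ 4) ltac:(rewrite Rabs_pos_eq; lra)
              (eps / (c + 1)) ltac:(apply Rdiv_lt_0_compat; lra)) as [N HN].
  exists N. intros k Hk. specialize (HN k Hk).
  pose proof (pow_lt (/ 4) k ltac:(lra)).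
  rewrite Rabs_pos_eq in HN by lra.
  apply (Rmult_lt_compat_l (c + 1)) in HN; [|lra].
  replace ((c + 1) * (eps / (c + 1))) with eps in HN by (field; lra).
  nra.
Qed.

(** The operator [Lim_seq] is total; the Cauchy estimate [picard_tail] makes this a genuine finite
    limit. *)
Definition flow (x0 A P x : R) : R := real (Lim_seq (fun k => picard x0 A P k x)).

Lemma picard_cvg (x0 A P x : R) :
  is_lim_seq (fun k => picard x0 A P k x) (flow x0 A P x).
Proof.
  apply Lim_seq_correct', ex_lim_seq_cauchy_corr. intros [eps Heps]; simpl.
  pose proof (Rabs_pos P). pose proof (weight_ge1 kappa x0 x).
  destruct (pow_quarter_small (4 * (Rabs P + 1) * weight kappa x0 x) eps)
    as [N HN]; [|exact Heps|].
  { apply Rmult_le_pos; lra. }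
  specialize (HN N (le_n N)).
  exists N. intros p q Hp Hq.
  pose proof (picard_tail x0 A P N (p - N) x) as Tp.
  pose proof (picard_tail x0 A P N (q - N) x) as Tq.
  replace (N + (p - N))%nat with p in Tp by lia.
  replace (N + (q - N))%nat with q in Tq by lia.
  replace (picard x0 A P p x - picard x0 A P q x)
    with ((picard x0 A P p x - picard x0 A P N x)
          - (picard x0 A P q x - picard x0 A P N x)) by ring.
  eapply Rle_lt_trans; [apply Rabs_triang|]. rewrite Rabs_Ropp. lra.
Qed.

Lemma picard_error (x0 A P : R) (k : nat) (x : R) :
  Rabs (flow x0 A P x - picard x0 A P k x)
    <= 2 * (Rabs P + 1) * (/ 4) ^ k * weight kappa x0 x.
Proof.
  assert (Hl : is_lim_seq (fun j => Rabs (picard x0 A P (k + j) x - picard x0 A P k x))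
                 (Rabs (flow x0 A P x - picard x0 A P k x))).
  { apply (is_lim_seq_abs _ (Finite (flow x0 A P x - picard x0 A P k x))).
    apply is_lim_seq_minus'; [|apply is_lim_seq_const].
    apply (is_lim_seq_ext (fun j => picard x0 A P (j + k) x));
      [intros j; now rewrite Nat.add_comm|].
    apply (is_lim_seq_incr_n (fun j => picard x0 A P j x)), picard_cvg. }
  exact (is_lim_seq_le _ _ _ _ (fun j => picard_tail x0 A P k j x) Hl
           (is_lim_seq_const _)).
Qed.

Lemma flow_continuous (x0 A P x : R) : continuous (flow x0 A P) x.
Proof.
  apply (proj2 (filterlim_locally _ _)). intros [eps Heps].
  pose proof (Rabs_pos P). pose proof (weight_ge1 kappa x0 x).
  (* Near [x] the weight is at most its value at [x] plus 1, so this [N] keeps the iteration error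
     below [eps / 3] on a whole neighbourhood. *)
  destruct (pow_quarter_small (2 * (Rabs P + 1) * (weight kappa x0 x + 1)) (eps / 3))
    as [N HN]; [|lra|].
  { apply Rmult_le_pos; lra. }
  specialize (HN N (le_n N)).
  pose proof (proj1 (filterlim_locally _ _) (picard_continuous x0 A P N x)
                (mkposreal (eps / 3) ltac:(lra))) as H1.
  assert (Hw : continuous (weight kappa x0) x).
  { apply (ex_derive_continuous (weight kappa x0)). eexists.
    now apply is_derive_weight. }
  pose proof (proj1 (filterlim_locally _ _) Hw (mkposreal 1 Rlt_0_1)) as H2.
  generalize (filter_and _ _ H1 H2). apply filter_imp. intros y [B1 B2].
  change (Rabs (picard x0 A P N y - picard x0 A P N x) < eps / 3) in B1.
  change (Rabs (weight kappa x0 y - weight kappa x0 x) < 1) in B2.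
  change (Rabs (flow x0 A P y - flow x0 A P x) < eps).
  apply Rabs_def2 in B2.
  pose proof (pow_le (/ 4) N ltac:(lra)).
  pose proof (picard_error x0 A P N x) as Ex.
  pose proof (picard_error x0 A P N y) as Ey.
  assert (0 <= 2 * (Rabs P + 1) * (/ 4) ^ N) by (apply Rmult_le_pos; lra).
  assert (Rabs (flow x0 A P x - picard x0 A P N x) < eps / 3) by nra.
  assert (Rabs (flow x0 A P y - picard x0 A P N y) < eps / 3) by nra.
  replace (flow x0 A P y - flow x0 A P x)
    with ((flow x0 A P y - picard x0 A P N y)
          + (picard x0 A P N y - picard x0 A P N x)
          - (flow x0 A P x - picard x0 A P N x)) by ring.
  eapply Rle_lt_trans; [apply Rabs_triang|]. rewrite Rabs_Ropp.
  pose proof (Rabs_triang (flow x0 A P y - picard x0 A P N y)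
                (picard x0 A P N y - picard x0 A P N x)). lra.
Qed.

(** Both sides are close to the iterate of index [S N]: the left one by contraction from the iterate
    [N], the right one by the error estimate. The contraction applies to [flow] because [flow] is
    continuous. *)
Lemma flow_fixpoint (x0 A P x : R) : picard_map x0 A P (flow x0 A P) x = flow x0 A P x.
Proof.
  apply cond_eq. intros eps Heps.
  pose proof (Rabs_pos P). pose proof (weight_ge1 kappa x0 x).
  destruct (pow_quarter_small (4 * (Rabs P + 1) * weight kappa x0 x) eps)
    as [N HN]; [|lra|].
  { apply Rmult_le_pos; lra. }
  specialize (HN N (le_n N)).
  pose proof (pow_le (/ 4) N ltac:(lra)) as Hp.
  assert (0 <= 2 * (Rabs P + 1) * (/ 4) ^ N) by (apply Rmult_le_pos; lra).
  pose proof (picard_map_contract x0 A P (2 * (Rabs P + 1) * (/ 4) ^ N) x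
    (flow x0 A P) (picard x0 A P N) ltac:(assumption)
    (flow_continuous x0 A P) (picard_continuous x0 A P N)
    (picard_error x0 A P N)) as E1.
  pose proof (picard_error x0 A P (S N) x) as E2.
  change (picard x0 A P (S N) x) with (picard_map x0 A P (picard x0 A P N) x) in E2.
  replace ((/ 4) ^ (S N)) with ((/ 4) ^ N / 4) in E2 by (simpl; field).
  replace (picard_map x0 A P (flow x0 A P) x - flow x0 A P x)
    with ((picard_map x0 A P (flow x0 A P) x - picard_map x0 A P (picard x0 A P N) x)
      - (flow x0 A P x - picard_map x0 A P (picard x0 A P N) x)) by ring.
  eapply Rle_lt_trans; [apply Rabs_triang|]. rewrite Rabs_Ropp.
  assert (0 <= (Rabs P + 1) * (/ 4) ^ N * weight kappa x0 x).
  { repeat apply Rmult_le_pos; lra. }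
  nra.
Qed.

Lemma flow_solution (x0 A P : R) :
  solution x0 A P (flow x0 A P) (picard_slope x0 P (flow x0 A P)).
Proof.
  pose proof (flow_continuous x0 A P) as Hc.
  split; [|split; [|split]].
  - intros x. apply (is_derive_ext (picard_map x0 A P (flow x0 A P))).
    + intros y. apply flow_fixpoint.
    + now apply is_derive_picard_map.
  - intros x. now apply is_derive_picard_slope.
  - rewrite <- flow_fixpoint. apply picard_map_base.
  - apply picard_slope_base.
Qed.

(** On the ball of radius [|x - x0|] the maximum [q] of the weighted difference satisfies
    [q <= data + q / 4], hence [q <= 4 / 3 * data], rounded up to 2. The solutions are arbitrary, so
    uniqueness is included, and a solution known only to exist can be compared with a [flow]. *)
Lemma solution_dependence (x0 A P A' P' x : R) (u m u' m' : R -> R) :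
  solution x0 A P u m -> solution x0 A' P' u' m' ->
  Rabs (u x - u' x) <= 2 * (Rabs (A - A') + Rabs (P - P')) * weight kappa x0 x.
Proof.
  intros [Du [Dm [HA HP]]] [Du' [Dm' [HA' HP']]].
  set (rho := Rabs (x - x0)).
  set (q := fun y => Rabs (u y - u' y) / weight kappa x0 y).
  assert (Hq : forall y, continuity_pt q y).
  { intros y. unfold q. pose proof (weight_ge1 kappa x0 y).
    apply (continuity_pt_div (fun z => Rabs (u z - u' z)) (weight kappa x0)); [| |lra].
    - apply (continuity_pt_comp (fun z => u z - u' z) Rabs); [|apply Rcontinuity_abs].
      apply (continuity_pt_minus u u').
      + exact (is_derive_continuity_pt _ _ _ (Du y)).
      + exact (is_derive_continuity_pt _ _ _ (Du' y)).
    - exact (is_derive_continuity_pt _ _ _ (is_derive_weight kappa x0 kappa_cont y)). }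
  assert (Hrho : 0 <= rho) by apply Rabs_pos.
  destruct (continuity_ab_maj q (x0 - rho) (x0 + rho)) as [xm [Hmax Hxm]];
    [lra|intros y _; apply Hq|].
  assert (Hd : 0 <= q xm).
  { unfold q. pose proof (weight_ge1 kappa x0 xm).
    apply Rdiv_le_0_compat; [apply Rabs_pos|lra]. }
  assert (Hball : forall y, Rabs (y - x0) <= rho ->
            Rabs (u y - u' y) <= q xm * weight kappa x0 y).
  { intros y Hy. apply Rabs_le_between in Hy.
    pose proof (weight_ge1 kappa x0 y).
    specialize (Hmax y ltac:(lra)).
    apply Rle_trans with (q y * weight kappa x0 y).
    - unfold q. right. field. lra.
    - apply Rmult_le_compat_r; lra. }
  assert (Hstep : forall y, Rabs (y - x0) <= rho ->
    Rabs (u y - u' y) <= (Rabs (A - A') + Rabs (P - P') + q xm / 4) * weight kappa x0 y).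
  { intros y Hy.
    apply (integration_step_bound x0 (A - A') (P - P') (q xm) y
      (fun z => h z (u z) - h z (u' z)) (fun z => u z - u' z) (fun z => m z - m' z)).
    - exact Hd.
    - intros z. replace (a z * (m z - m' z)) with (a z * m z - a z * m' z) by ring.
      now apply (@is_derive_minus R_AbsRing R_NormedModule).
    - intros z. now apply (@is_derive_minus R_AbsRing R_NormedModule).
    - now rewrite HA, HA'.
    - now rewrite HP, HP'.
    - intros z Hz. eapply Rle_trans; [apply h_lip|].
      replace (q xm * (kappa z * weight kappa x0 z))
        with (kappa z * (q xm * weight kappa x0 z)) by ring.
      apply Rmult_le_compat_l; [apply kappa_nonneg|apply Hball]. lra. }
  assert (Hqm : q xm <= Rabs (A - A') + Rabs (P - P') + q xm / 4).
  { pose proof (weight_ge1 kappa x0 xm).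
    assert (Hin : Rabs (xm - x0) <= rho) by (apply Rabs_le; lra).
    specialize (Hstep xm Hin).
    unfold q at 1. apply Rle_div_l; lra. }
  eapply Rle_trans; [apply Hball; unfold rho; lra|].
  pose proof (weight_ge1 kappa x0 x).
  pose proof (Rabs_pos (A - A')). pose proof (Rabs_pos (P - P')).
  apply Rmult_le_compat_r; lra.
Qed.

Lemma flow_continuity_in_slope (x0 A x : R) : continuity (fun P => flow x0 A P x).
Proof.
  intros P eps Heps. pose proof (weight_ge1 kappa x0 x).
  exists (eps / (2 * weight kappa x0 x)).
  split; [apply Rdiv_lt_0_compat; lra|].
  intros P' [_ HP']. simpl in *. unfold R_dist in *.
  eapply Rle_lt_trans.
  - eapply (solution_dependence x0 A P' A P); apply flow_solution.
  - rewrite Rminus_diag, Rabs_R0.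
    apply (Rmult_lt_compat_l (2 * weight kappa x0 x)) in HP'; [|lra].
    replace (2 * weight kappa x0 x * (eps / (2 * weight kappa x0 x)))
      with eps in HP' by (field; lra).
    lra.
Qed.

(* Shooting: a slope dominating the total variation of [m] makes [u] monotone. *)
Lemma dirichlet_solvable (A x0 x1 : R) :
  x0 < x1 -> (forall x, 0 < a x) ->
  exists u m, (forall x, is_derive u x (a x * m x)) /\
    (forall x, is_derive m x (h x (u x))) /\ u x0 = A /\ u x1 = A.
Proof.
  intros Hx Ha.
  destruct (continuity_ab_maj kappa x0 x1) as [xm [Hmax _]]; [lra| |].
  { intros y _. apply continuity_pt_filterlim, kappa_cont. }
  set (Q := kappa xm * (x1 - x0)).
  pose proof (kappa_nonneg xm).
  assert (HQ : 0 <= Q) by (apply Rmult_le_pos; lra).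
  assert (Hslope : forall P y, x0 <= y <= x1 ->
            Rabs (picard_slope x0 P (flow x0 A P) y - P) <= Q).
  { intros P y Hy. destruct (flow_solution x0 A P) as [_ [Dm [_ HP]]].
    destruct (MVT_is_derive _ _ x0 y Dm) as [c [Hc Ec]].
    rewrite HP in Ec. rewrite Ec, Rabs_mult.
    rewrite Rmin_left, Rmax_right in Hc by lra.
    pose proof (h_bound c (flow x0 A P c)). specialize (Hmax c ltac:(lra)).
    rewrite (Rabs_pos_eq (y - x0)) by lra.
    apply Rmult_le_compat; try apply Rabs_pos; lra. }
  (* The end value minus [A] has the sign of some value of [m], which lies within [Q] of [P]; hence
     [P = Q] and [P = - Q] give (weakly) opposite signs. *)
  assert (Hend : forall P, exists c m, Rabs (m - P) <= Q /\ 0 < a c /\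
            flow x0 A P x1 - A = a c * m * (x1 - x0)).
  { intros P. destruct (flow_solution x0 A P) as [Du [_ [HA _]]].
    destruct (MVT_is_derive _ _ x0 x1 Du) as [c [Hc Ec]].
    rewrite Rmin_left, Rmax_right in Hc by lra.
    exists c, (picard_slope x0 P (flow x0 A P) c). split; [now apply Hslope|].
    split; [apply Ha|]. now rewrite HA in Ec. }
  destruct (IVT_cor (fun P => flow x0 A P x1 - A) (- Q) Q) as [P [_ HP]].
  - apply (continuity_minus (fun P => flow x0 A P x1) (fun _ => A)).
    + apply flow_continuity_in_slope.
    + apply continuity_const. now intros ? ?.
  - lra.
  - destruct (Hend (- Q)) as [c1 [m1 [H1 [Hc1 E1]]]].
    destruct (Hend Q) as [c2 [m2 [H2 [Hc2 E2]]]].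
    apply Rabs_le_between in H1, H2.
    assert (H3 : 0 <= flow x0 A Q x1 - A) by (rewrite E2; repeat apply Rmult_le_pos; lra).
    assert (H4 : 0 <= - (flow x0 A (- Q) x1 - A)).
    { rewrite E1. replace (- (a c1 * m1 * (x1 - x0))) with (a c1 * (- m1) * (x1 - x0)) by ring.
      repeat apply Rmult_le_pos; lra. }
    pose proof (Rmult_le_pos _ _ H3 H4). lra.
  - destruct (flow_solution x0 A P) as [Du [Dm [HA _]]].
    exists (flow x0 A P), (picard_slope x0 P (flow x0 A P)).
    split; [exact Du|split; [exact Dm|split; [exact HA|lra]]].
Qed.

(** Compactness is used only for the two numbers [u 0] and [m 0]; continuous dependence then carries
    the barriers to the limit at each fixed [x]. The bound [/ a <= kappa] converts a bound on the
    increment of [u] into one on [m]. *)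
Lemma entire_solution_between (A : R) (lo hi : R -> R) :
  (forall x, 0 < a x) -> (forall x, / a x <= kappa x) ->
  (forall (n : nat) u m,
    (forall x, is_derive u x (a x * m x)) -> (forall x, is_derive m x (h x (u x))) ->
    u (- INR n) = A -> u (INR n) = A ->
    forall x, - INR n <= x <= INR n -> lo x <= u x <= hi x) ->
  exists u m, (forall x, is_derive u x (a x * m x)) /\
    (forall x, is_derive m x (h x (u x))) /\ (forall x, lo x <= u x <= hi x).
Proof.
  intros Ha Hia Hbar.
  set (S := fun (n : nat) A' P' => exists u m, solution 0 A' P' u m /\
              forall x, - INR n <= x <= INR n -> lo x <= u x <= hi x).
  destruct (continuity_ab_maj kappa 0 1) as [xm [Hmax _]]; [lra| |].
  { intros y _. apply continuity_pt_filterlim, kappa_cont. }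
  set (B := Rabs (lo 0) + Rabs (hi 0) + Rabs (lo 1) + Rabs (hi 1)).
  set (Q := (B + 1) * kappa xm).
  (* The shift to [n + 1] makes every interval contain [[0, 1]], where the slope at 0 is
     estimated. *)
  destruct (real_pair_cluster (fun n => S (n + 1)%nat) (lo 0) (hi 0) (- Q) Q)
    as [A0 [P0 Hcl]].
  { intros n.
    assert (Hn : 1 <= INR (n + 1)).
    { rewrite plus_INR. pose proof (pos_INR n). simpl. lra. }
    destruct (dirichlet_solvable A (- INR (n + 1)) (INR (n + 1)))
      as [u [m [Du [Dm [H1 H2]]]]]; [lra|exact Ha|].
    pose proof (Hbar _ u m Du Dm H1 H2) as Hu.
    exists (u 0), (m 0).
    split; [exists u, m; split;
      [split; [exact Du|split; [exact Dm|split; reflexivity]]|exact Hu]|].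
    split; [apply Hu; lra|].
    (* The value [m c = (u 1 - u 0) / a c] is controlled by the barriers at 0 and 1, and [m] changes
       by at most [kappa xm] between 0 and [c]; this explains [Q = (B + 1) * kappa xm]. *)
    destruct (MVT_is_derive _ _ 0 1 Du) as [c [Hc Ec]].
    destruct (MVT_is_derive _ _ 0 c Dm) as [e [He Ee]].
    rewrite Rmin_left, Rmax_right in Hc by lra.
    rewrite Rmin_left, Rmax_right in He by lra.
    pose proof (Hu 0 ltac:(lra)) as U0. pose proof (Hu 1 ltac:(lra)) as U1.
    assert (Hmc : Rabs (m c) <= B * kappa xm).
    { replace (m c) with ((u 1 - u 0) * / a c)
        by (rewrite Ec; field; specialize (Ha c); lra).
      rewrite Rabs_mult, (Rabs_pos_eq (/ a c))
        by (left; now apply Rinv_0_lt_compat).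
      apply Rmult_le_compat; [apply Rabs_pos|left; now apply Rinv_0_lt_compat| |].
      - unfold B. clear - U0 U1. unfold Rabs. repeat destruct Rcase_abs; lra.
      - specialize (Hia c). specialize (Hmax c Hc). lra. }
    assert (Hme : Rabs (m c - m 0) <= kappa xm).
    { rewrite Ee, Rabs_mult. pose proof (h_bound e (u e)).
      specialize (Hmax e ltac:(lra)). rewrite (Rabs_pos_eq (c - 0)) by lra.
      pose proof (Rabs_pos (h e (u e))). nra. }
    apply Rabs_le_between in Hmc, Hme. unfold Q. lra. }
  destruct (flow_solution 0 A0 P0) as [Du [Dm [HA HP]]].
  exists (flow 0 A0 P0), (picard_slope 0 P0 (flow 0 A0 P0)).
  split; [exact Du|split; [exact Dm|]]. intros x.
  assert (Hclose : forall eps, 0 < eps -> exists y, lo x <= y <= hi x /\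
            Rabs (flow 0 A0 P0 x - y) < eps).
  { intros eps Heps. pose proof (weight_ge1 kappa 0 x) as Hw.
    destruct (nfloor_ex (Rabs x)) as [N HN]; [apply Rabs_pos|].
    (* Two data errors of this size, times the dependence constant [2 * weight], add up to [eps].
       Since [|x| < N + 1], the interval of index [n + 1] contains [x]. *)
    destruct (Hcl (eps / (4 * weight kappa 0 x)) N)
      as [n [A' [P' [Hn [[u [m [Hs Hu]]] [HA' HP']]]]]];
      [apply Rdiv_lt_0_compat; lra|].
    exists (u x). split.
    - apply Hu, Rabs_le_between.
      assert (INR (N + 1) <= INR (n + 1)) by (apply le_INR; lia).
      rewrite plus_INR in H. simpl in H. lra.
    - pose proof (solution_dependence 0 A' P' A0 P0 x _ _ _ _ Hs
        (flow_solution 0 A0 P0)) as Hd.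
      rewrite Rabs_minus_sym. eapply Rle_lt_trans; [exact Hd|].
      assert (Hsum : Rabs (A' - A0) + Rabs (P' - P0) < eps / (2 * weight kappa 0 x)).
      { replace (eps / (2 * weight kappa 0 x))
          with (eps / (4 * weight kappa 0 x) + eps / (4 * weight kappa 0 x))
          by (field; lra). lra. }
      apply (Rmult_lt_compat_r (2 * weight kappa 0 x)) in Hsum; [|lra].
      replace (eps / (2 * weight kappa 0 x) * (2 * weight kappa 0 x))
        with eps in Hsum by (field; lra). lra. }
  split; apply Rnot_lt_le; intros Hlt.
  - destruct (Hclose (lo x - flow 0 A0 P0 x)) as [y [Hy Hd]]; [lra|].
    apply Rabs_def2 in Hd. lra.
  - destruct (Hclose (flow 0 A0 P0 x - hi x)) as [y [Hy Hd]]; [lra|].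
    apply Rabs_def2 in Hd. lra.
Qed.

End System.

(** * Maximum principle and barriers *)

Lemma interior_max_derivatives (d d1 : R -> R) (x d2 x0 x1 : R) :
  x0 < x < x1 ->
  (forall y, is_derive d y (d1 y)) -> is_derive d1 x d2 ->
  (forall y, x0 <= y <= x1 -> d y <= d x) ->
  d1 x = 0 /\ d2 <= 0.
Proof.
  intros Hx Hd Hd1 Hmax.
  assert (H0 : d1 x = 0).
  { pose proof (proj1 (is_derive_Reals d x (d1 x)) (Hd x)) as Hr.
    set (pr := exist _ (d1 x) Hr : derivable_pt d x).
    change (derive_pt d x pr = 0).
    apply (deriv_maximum d x0 x1 x pr); [lra|lra|]. intros y Hy1 Hy2. apply Hmax. lra. }
  split; [exact H0|].
  (* If [d2 > 0], then [d1 > 0] just to the right of [x], and [d] would exceed its maximum at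
     [x + s]. *)
  apply Rnot_lt_le. intros Hpos.
  destruct (proj1 (is_derive_Reals d1 x d2) Hd1 (d2 / 2)) as [delta Hdelta]; [lra|].
  pose proof (cond_pos delta) as Hdel.
  set (s := Rmin (delta / 2) (x1 - x)).
  assert (Hs : 0 < s <= delta / 2 /\ s <= x1 - x).
  { unfold s. split; [split|]; [apply Rmin_glb_lt; lra|apply Rmin_l|apply Rmin_r]. }
  destruct (MVT_cor2 d d1 x (x + s)) as [c [Ec Hc]]; [lra| |].
  { intros y _. apply is_derive_Reals, Hd. }
  specialize (Hdelta (c - x) ltac:(lra)).
  rewrite H0 in Hdelta. replace (x + (c - x)) with c in Hdelta by ring.
  rewrite (Rabs_pos_eq (c - x)) in Hdelta by lra.
  specialize (Hdelta ltac:(lra)). apply Rabs_def2 in Hdelta.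
  assert (Hc1 : 0 < (d1 c - 0) / (c - x)) by lra.
  apply (Rmult_lt_compat_r (c - x)) in Hc1; [|lra].
  replace ((d1 c - 0) / (c - x) * (c - x)) with (d1 c) in Hc1 by (field; lra).
  specialize (Hmax (x + s) ltac:(lra)). nra.
Qed.

(** A positive maximum would be interior, with [d1 = 0] and [d2 <= 0]. Restricting the sign
    condition to critical points where [d > 0] suits the barriers: there the first-order term is
    known and the clamp has put the barrier value into the nonlinearity. *)
Lemma maximum_principle (d d1 d2 : R -> R) (x0 x1 x : R) :
  (forall y, is_derive d y (d1 y)) -> (forall y, is_derive d1 y (d2 y)) ->
  d x0 <= 0 -> d x1 <= 0 ->
  (forall y, 0 < d y -> d1 y = 0 -> 0 < d2 y) ->
  x0 <= x <= x1 -> d x <= 0.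
Proof.
  intros Hd Hd1 H0 H1 Hpos Hx.
  destruct (continuity_ab_maj d x0 x1) as [xm [Hmax Hxm]]; [lra| |].
  { intros y _. exact (is_derive_continuity_pt _ _ _ (Hd y)). }
  apply Rnot_lt_le. intros Hlt. specialize (Hmax x Hx) as Hxx.
  assert (Hin : x0 < xm < x1).
  { destruct (Req_dec xm x0) as [->|]; [lra|].
    destruct (Req_dec xm x1) as [->|]; lra. }
  destruct (interior_max_derivatives d d1 xm (d2 xm) x0 x1 Hin Hd (Hd1 xm) Hmax)
    as [E1 E2].
  specialize (Hpos xm ltac:(lra) E1). lra.
Qed.

(** * Continuity rules, the exponential and the clamp *)

Lemma is_derive_continuous (f : R -> R) (x l : R) : is_derive f x l -> continuous f x.
Proof. intros Hf. apply (ex_derive_continuous f). now exists l. Qed.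

Lemma continuous_Rplus (f g : R -> R) (x : R) :
  continuous f x -> continuous g x -> continuous (fun y => f y + g y) x.
Proof. apply (continuous_plus f g). Qed.

Lemma continuous_Rminus (f g : R -> R) (x : R) :
  continuous f x -> continuous g x -> continuous (fun y => f y - g y) x.
Proof. apply (continuous_minus f g). Qed.

Lemma continuous_Rmult (f g : R -> R) (x : R) :
  continuous f x -> continuous g x -> continuous (fun y => f y * g y) x.
Proof. apply (continuous_mult f g). Qed.

Lemma continuous_Ropp (f : R -> R) (x : R) :
  continuous f x -> continuous (fun y => - f y) x.
Proof. apply (continuous_opp f). Qed.

Lemma continuous_exp_comp (f : R -> R) (x : R) :
  continuous f x -> continuous (fun y => exp (f y)) x.
Proof.
  intros Hf. apply (continuous_comp f exp); [exact Hf|].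
  apply (is_derive_continuous exp _ (exp (f x))), is_derive_exp.
Qed.

Lemma continuous_Rinv_comp (f : R -> R) (x : R) :
  continuous f x -> f x <> 0 -> continuous (fun y => / f y) x.
Proof. intros Hf H0. now apply (continuous_Rinv_comp f). Qed.

Lemma Rmax_abs (x y : R) : Rmax x y = (x + y + Rabs (x - y)) / 2.
Proof.
  unfold Rmax, Rabs. destruct (Rle_dec x y); destruct Rcase_abs; lra.
Qed.

Lemma continuous_Rmax_comp (f g : R -> R) (x : R) :
  continuous f x -> continuous g x -> continuous (fun y => Rmax (f y) (g y)) x.
Proof.
  intros Hf Hg.
  apply (continuous_ext (fun y => (f y + g y + Rabs (f y - g y)) * / 2)).
  { intros y. now rewrite Rmax_abs. }
  apply continuous_Rmult; [|apply continuous_const].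
  apply continuous_Rplus; [now apply continuous_Rplus|].
  apply (continuous_comp (fun y => f y - g y) Rabs); [now apply continuous_Rminus|].
  apply continuous_Rabs.
Qed.

Lemma continuous_Rmin_comp (f g : R -> R) (x : R) :
  continuous f x -> continuous g x -> continuous (fun y => Rmin (f y) (g y)) x.
Proof.
  intros Hf Hg.
  apply (continuous_ext (fun y => - Rmax (- f y) (- g y))).
  { intros y. rewrite Ropp_Rmax, !Ropp_involutive. reflexivity. }
  apply continuous_Ropp, continuous_Rmax_comp; now apply continuous_Ropp.
Qed.

Ltac continuity_R :=
  repeat match goal with
  | |- continuous (fun _ => _ + _) _ => apply continuous_Rplus
  | |- continuous (fun _ => _ - _) _ => apply continuous_Rminus
  | |- continuous (fun _ => _ * _) _ => apply continuous_Rmult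
  | |- continuous (fun _ => - _) _ => apply continuous_Ropp
  | |- continuous (fun _ => exp _) _ => apply continuous_exp_comp
  | |- continuous (fun _ => ?c) _ => apply continuous_const
  end; auto.

Lemma exp_lipschitz_below (u v t : R) :
  u <= t -> v <= t -> Rabs (exp u - exp v) <= exp t * Rabs (u - v).
Proof.
  intros Hu Hv.
  destruct (MVT_is_derive exp exp v u is_derive_exp) as [c [Hc Ec]].
  rewrite Ec, Rabs_mult, (Rabs_pos_eq (exp c)) by (left; apply exp_pos).
  apply Rmult_le_compat_r; [apply Rabs_pos|].
  assert (Hct : c <= t) by (destruct Hc as [_ Hc]; revert Hc; unfold Rmax; destruct Rle_dec; lra).
  destruct Hct as [Hlt| ->]; [left; now apply exp_increasing|apply Rle_refl].
Qed.

Lemma clamp_lipschitz (lo hi u v : R) :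
  Rabs (Rmax lo (Rmin u hi) - Rmax lo (Rmin v hi)) <= Rabs (u - v).
Proof.
  unfold Rmax, Rmin, Rabs.
  repeat destruct Rle_dec; repeat destruct Rcase_abs; lra.
Qed.

Lemma clamp_between (lo hi u : R) : lo <= hi -> lo <= Rmax lo (Rmin u hi) <= hi.
Proof. unfold Rmax, Rmin. repeat destruct Rle_dec; lra. Qed.

Lemma clamp_id (lo hi u : R) : lo <= u <= hi -> Rmax lo (Rmin u hi) = u.
Proof. unfold Rmax, Rmin. repeat destruct Rle_dec; lra. Qed.

(* With [E = exp (RInt beta 0 x)], the equation reads [(E * V1)' = E * g x V];
   [g] is first evaluated at the value of [V] clamped between the barriers. *)
Lemma solution_between_barriers (beta w w1 w2 kap : R -> R) (g : R -> R -> R) (lo : R) :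
  (forall x, continuous beta x) ->
  (forall x, is_derive w x (w1 x)) -> (forall x, is_derive w1 x (w2 x)) ->
  (forall x, lo <= w x) ->
  (forall x, continuous kap x) ->
  (forall x v, lo <= v <= w x -> Rabs (g x v) <= kap x) ->
  (forall x u v, lo <= u <= w x -> lo <= v <= w x ->
    Rabs (g x u - g x v) <= kap x * Rabs (u - v)) ->
  (forall u, (forall x, continuous u x) ->
    forall x, continuous (fun z => g z (u z)) x) ->
  (forall x, g x lo < 0) ->
  (forall x, w2 x + beta x * w1 x < g x (w x)) ->
  exists V V1, (forall x, is_derive V x (V1 x)) /\
    (forall x, is_derive V1 x (g x (V x) - beta x * V1 x)) /\
    (forall x, lo <= V x <= w x).
Proof.
  intros Hbeta Hw Hw1 Hlow Hkap Hgb Hgl Hgc Hsub Hsup.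
  set (B := (fun x => RInt beta 0 x) : R -> R).
  assert (HB : forall x, is_derive B x (beta x)).
  { intros x. now apply is_derive_RInt_continuous. }
  clearbody B.
  set (a := fun x => exp (- B x)).
  set (cl := fun x v => Rmax lo (Rmin v (w x))).
  set (h := fun x v => exp (B x) * g x (cl x v)).
  (* The three terms dominate, in this order, [1 / a], [a], and both [|h|] and its Lipschitz
     constant. *)
  set (kappa := fun x => exp (B x) + exp (- B x) + exp (B x) * kap x).
  assert (HBc : forall x, continuous B x)
    by (intros x; apply (is_derive_continuous _ _ _ (HB x))).
  assert (Hcl : forall x v, lo <= cl x v <= w x)
    by (intros x v; apply clamp_between, Hlow).
  assert (Hkap0 : forall x, 0 <= kap x).
  { intros x. specialize (Hgb x lo (conj (Rle_refl lo) (Hlow x))).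
    pose proof (Rabs_pos (g x lo)). lra. }
  assert (Hcompare : forall x, 0 < exp (B x) /\ 0 < exp (- B x) /\
            0 <= exp (B x) * kap x).
  { intros x. split; [apply exp_pos|]. split; [apply exp_pos|].
    apply Rmult_le_pos; [left; apply exp_pos|apply Hkap0]. }
  assert (Hcancel : forall x, a x * exp (B x) = 1).
  { intros x. unfold a. rewrite <- exp_plus, Rplus_opp_l. apply exp_0. }
  assert (Ham : forall u m,
    (forall x, is_derive m x (h x (u x))) -> forall x,
    is_derive (fun y => a y * m y) x (g x (cl x (u x)) - beta x * (a x * m x))).
  { intros u m Hm x. unfold a. auto_derive.
    - repeat split; eexists; [apply HB|apply Hm].
    - rewrite_derive B x (HB x). rewrite_derive m x (Hm x). unfold h.
      replace (1 * exp (- B x) * (exp (B x) * g x (cl x (u x))))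
        with (a x * exp (B x) * g x (cl x (u x))) by (unfold a; ring).
      replace (exp (- B x) * (1 * (exp (B x) * g x (cl x (u x)))))
        with (a x * exp (B x) * g x (cl x (u x))) by (unfold a; ring).
      rewrite Hcancel. ring. }
  (* The boundary value [lo] lies between the barriers at both ends, because [lo <= w]. *)
  destruct (entire_solution_between a kappa h) with (A := lo) (lo := fun _ : R => lo) (hi := w)
    as [u [m [Du [Dm Hu]]]].
  - intros x. unfold a. continuity_R.
  - intros x. unfold kappa. continuity_R.
  - intros x. destruct (Hcompare x) as [H1 [H2 H3]]. unfold a, kappa.
    rewrite Rabs_pos_eq; lra.
  - intros x v. destruct (Hcompare x) as [H1 [H2 H3]]. unfold h, kappa.
    rewrite Rabs_mult, (Rabs_pos_eq (exp (B x))) by lra.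
    specialize (Hgb x _ (Hcl x v)).
    apply (Rmult_le_compat_l (exp (B x))) in Hgb; lra.
  - intros x u v. destruct (Hcompare x) as [H1 [H2 H3]]. unfold h, kappa.
    rewrite <- Rmult_minus_distr_l, Rabs_mult, (Rabs_pos_eq (exp (B x))) by lra.
    pose proof (clamp_lipschitz lo (w x) u v) as Hcl1.
    fold (cl x u) in Hcl1. fold (cl x v) in Hcl1.
    specialize (Hgl x _ _ (Hcl x u) (Hcl x v)).
    specialize (Hkap0 x). pose proof (Rabs_pos (u - v)).
    apply Rle_trans with (exp (B x) * (kap x * Rabs (u - v))).
    + apply Rmult_le_compat_l; [lra|]. eapply Rle_trans; [exact Hgl|].
      apply Rmult_le_compat_l; lra.
    + nra.
  - intros u Hu x. unfold h. continuity_R.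
    apply (Hgc (fun z => cl z (u z))). intros z. unfold cl.
    apply continuous_Rmax_comp; [apply continuous_const|].
    apply continuous_Rmin_comp; [apply Hu|].
    exact (is_derive_continuous _ _ _ (Hw z)).
  - intros x. apply exp_pos.
  - intros x. destruct (Hcompare x) as [H1 [H2 H3]]. unfold a, kappa.
    rewrite <- exp_Ropp, Ropp_involutive. lra.
  - intros n u m Du Dm H1 H2 x Hx.
    pose proof (Ham u m Dm) as Dam.
    assert (Hlo : lo - u x <= 0).
    { apply (maximum_principle (fun y => lo - u y) (fun y => - (a y * m y))
        (fun y => - (g y (cl y (u y)) - beta y * (a y * m y))) (- INR n) (INR n) x).
      - intros y. auto_derive; [eexists; apply Du|]. rewrite_derive u y (Du y). ring.
      - intros y. apply (is_derive_opp (fun y => a y * m y)), Dam.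
      - rewrite H1. lra.
      - rewrite H2. lra.
      (* Where [u < lo] the clamp returns [lo], and [a * m = 0] removes the drift; only
         [- g y lo > 0] remains. *)
      - intros y Hy E. assert (Ec : cl y (u y) = lo).
        { specialize (Hlow y). unfold cl, Rmax, Rmin. repeat destruct Rle_dec; lra. }
        rewrite Ec. specialize (Hsub y). replace (a y * m y) with 0 by lra. lra.
      - exact Hx. }
    assert (Hhi : u x - w x <= 0).
    { apply (maximum_principle (fun y => u y - w y) (fun y => a y * m y - w1 y)
        (fun y => g y (cl y (u y)) - beta y * (a y * m y) - w2 y) (- INR n) (INR n) x).
      - intros y. now apply (is_derive_minus u w).
      - intros y. apply (is_derive_minus (fun y => a y * m y) w1); [apply Dam|apply Hw1].
      - rewrite H1. specialize (Hlow (- INR n)). lra.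
      - rewrite H2. specialize (Hlow (INR n)). lra.
      (* Where [u > w] the clamp returns [w], and [a * m = w1] at a critical point; what remains is
         the strict inequality for [w]. *)
      - intros y Hy E. assert (Ec : cl y (u y) = w y).
        { specialize (Hlow y). unfold cl, Rmax, Rmin. repeat destruct Rle_dec; lra. }
        rewrite Ec. specialize (Hsup y). replace (a y * m y) with (w1 y) by lra. lra.
      - exact Hx. }
    lra.
  - exists u, (fun x => a x * m x). split; [exact Du|]. split; [|exact Hu].
    intros x. pose proof (Ham u m Dm x) as D.
    unfold cl in D. rewrite clamp_id in D by apply Hu. exact D.
Qed.

(** * Locally Lipschitz functions *)

(** Chosen in place of a Hölder class: it is stable under sums, products, inverses and [exp], and it
    yields all exponents below 1 at once. *)
Definition locally_lipschitz (g : R -> R) : Prop :=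
  forall M, exists C, 0 <= C /\
    forall x y, Rabs x <= M -> Rabs y <= M -> Rabs (g x - g y) <= C * Rabs (x - y).

Lemma locally_lipschitz_bounded (g : R -> R) (M : R) :
  locally_lipschitz g -> exists B, 0 <= B /\ forall x, Rabs x <= M -> Rabs (g x) <= B.
Proof.
  intros Hg. destruct (Hg M) as [C [HC Hlip]].
  exists (Rabs (g 0) + C * Rabs M).
  pose proof (Rabs_pos (g 0)) as H0. pose proof (Rabs_pos M) as HM.
  split; [pose proof (Rmult_le_pos C (Rabs M) HC HM); lra|].
  intros x Hx. pose proof (Rabs_pos x). pose proof (Rle_abs M).
  specialize (Hlip x 0 Hx ltac:(rewrite Rabs_R0; lra)).
  rewrite Rminus_0_r in Hlip.
  replace (g x) with (g 0 + (g x - g 0)) by ring.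
  eapply Rle_trans; [apply Rabs_triang|].
  assert (C * Rabs x <= C * Rabs M) by (apply Rmult_le_compat_l; lra). lra.
Qed.

Lemma locally_lipschitz_global (C : R) (g : R -> R) :
  lipschitz_with C g -> locally_lipschitz g.
Proof.
  intros Hg M. exists (Rabs C). split; [apply Rabs_pos|]. intros x y _ _.
  eapply Rle_trans; [apply Hg|].
  apply Rmult_le_compat_r; [apply Rabs_pos|apply Rle_abs].
Qed.

Lemma locally_lipschitz_plus (g k : R -> R) :
  locally_lipschitz g -> locally_lipschitz k -> locally_lipschitz (fun x => g x + k x).
Proof.
  intros Hg Hk M. destruct (Hg M) as [C [HC H1]]. destruct (Hk M) as [D [HD H2]].
  exists (C + D). split; [lra|]. intros x y Hx Hy.
  specialize (H1 x y Hx Hy). specialize (H2 x y Hx Hy).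
  replace (g x + k x - (g y + k y)) with ((g x - g y) + (k x - k y)) by ring.
  eapply Rle_trans; [apply Rabs_triang|]. lra.
Qed.

Lemma locally_lipschitz_mult (g k : R -> R) :
  locally_lipschitz g -> locally_lipschitz k -> locally_lipschitz (fun x => g x * k x).
Proof.
  intros Hg Hk M. destruct (Hg M) as [C [HC H1]]. destruct (Hk M) as [D [HD H2]].
  destruct (locally_lipschitz_bounded g M Hg) as [P [HP BP]].
  destruct (locally_lipschitz_bounded k M Hk) as [Q [HQ BQ]].
  exists (P * D + C * Q).
  split; [pose proof (Rmult_le_pos _ _ HP HD); pose proof (Rmult_le_pos _ _ HC HQ); lra|].
  intros x y Hx Hy.
  replace (g x * k x - g y * k y) with (g x * (k x - k y) + (g x - g y) * k y) by ring.
  eapply Rle_trans; [apply Rabs_triang|]. rewrite !Rabs_mult.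
  assert (Rabs (g x) * Rabs (k x - k y) <= P * (D * Rabs (x - y)))
    by (apply Rmult_le_compat; try apply Rabs_pos; auto).
  assert (Rabs (g x - g y) * Rabs (k y) <= C * Rabs (x - y) * Q)
    by (apply Rmult_le_compat; try apply Rabs_pos; auto).
  lra.
Qed.

Lemma locally_lipschitz_const (c : R) : locally_lipschitz (fun _ => c).
Proof.
  intros M. exists 0. split; [lra|]. intros x y _ _.
  rewrite Rminus_diag, Rabs_R0. lra.
Qed.

Lemma locally_lipschitz_opp (g : R -> R) :
  locally_lipschitz g -> locally_lipschitz (fun x => - g x).
Proof.
  intros Hg M. destruct (Hg M) as [C [HC H1]]. exists C. split; [exact HC|].
  intros x y Hx Hy. replace (- g x - - g y) with (- (g x - g y)) by ring.
  rewrite Rabs_Ropp. now apply H1.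
Qed.

Lemma locally_lipschitz_minus (g k : R -> R) :
  locally_lipschitz g -> locally_lipschitz k -> locally_lipschitz (fun x => g x - k x).
Proof.
  intros Hg Hk. apply (locally_lipschitz_plus g (fun x => - k x)); [exact Hg|].
  now apply locally_lipschitz_opp.
Qed.

Lemma locally_lipschitz_inv (g : R -> R) (delta : R) :
  0 < delta -> (forall x, delta <= Rabs (g x)) ->
  locally_lipschitz g -> locally_lipschitz (fun x => / g x).
Proof.
  intros Hdelta Hlow Hg M. destruct (Hg M) as [C [HC H1]].
  assert (Hd2 : 0 < / delta) by now apply Rinv_0_lt_compat.
  exists (/ delta * / delta * C). split; [repeat apply Rmult_le_pos; lra|].
  intros x y Hx Hy.
  assert (Hnz : forall z, g z <> 0).
  { intros z E. specialize (Hlow z). rewrite E, Rabs_R0 in Hlow. lra. }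
  assert (Hinv : forall z, Rabs (/ g z) <= / delta).
  { intros z. rewrite Rabs_inv. apply Rinv_le_contravar; auto. }
  replace (/ g x - / g y) with (/ g x * / g y * - (g x - g y)) by (field; auto).
  rewrite !Rabs_mult, Rabs_Ropp, (Rmult_assoc _ C).
  apply Rmult_le_compat; [apply Rmult_le_pos; apply Rabs_pos|apply Rabs_pos| |now apply H1].
  apply Rmult_le_compat; auto using Rabs_pos.
Qed.

Lemma locally_lipschitz_exp (g : R -> R) :
  locally_lipschitz g -> locally_lipschitz (fun x => exp (g x)).
Proof.
  intros Hg M. destruct (Hg M) as [C [HC H1]].
  destruct (locally_lipschitz_bounded g M Hg) as [P [HP BP]].
  exists (exp P * C). split; [apply Rmult_le_pos; [left; apply exp_pos|exact HC]|].
  intros x y Hx Hy.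
  pose proof (Rle_abs (g x)). pose proof (Rle_abs (g y)).
  pose proof (BP x Hx). pose proof (BP y Hy).
  eapply Rle_trans; [apply (exp_lipschitz_below (g x) (g y) P); lra|].
  rewrite Rmult_assoc. apply Rmult_le_compat_l; [left; apply exp_pos|now apply H1].
Qed.

Lemma locally_lipschitz_C1 (g g1 : R -> R) :
  (forall x, is_derive g x (g1 x)) -> (forall x, continuous g1 x) -> locally_lipschitz g.
Proof.
  intros Hg Hc M.
  destruct (Rle_dec 0 M) as [HM|HM].
  2: { exists 0. split; [lra|]. intros x y Hx. pose proof (Rabs_pos x). lra. }
  destruct (continuity_ab_maj (fun x => Rabs (g1 x)) (- M) M) as [xm [Hmax _]]; [lra| |].
  { intros x _. apply (continuity_pt_comp g1 Rabs); [|apply Rcontinuity_abs].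
    apply continuity_pt_filterlim, Hc. }
  exists (Rabs (g1 xm)). split; [apply Rabs_pos|]. intros x y Hx Hy.
  apply Rabs_le_between in Hx, Hy.
  destruct (MVT_is_derive g g1 y x Hg) as [c [Hcb Ec]].
  rewrite Ec, Rabs_mult. apply Rmult_le_compat_r; [apply Rabs_pos|].
  apply Hmax. revert Hcb. unfold Rmin, Rmax. destruct Rle_dec; lra.
Qed.

(** Split [|x - y|] into its powers [1 - alpha] and [alpha]; the first is bounded on a bounded
    set. *)
Lemma locally_lipschitz_holder (g : R -> R) (alpha : R) :
  alpha < 1 -> locally_lipschitz g -> holder_loc alpha g.
Proof.
  intros Ha Hg M. destruct (Hg M) as [C [HC Hlip]].
  exists (C * Rpower (2 * Rabs M + 1) (1 - alpha)).
  split; [apply Rmult_le_pos; [exact HC|left; apply exp_pos]|].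
  intros x y Hx Hy Hne. eapply Rle_trans; [now apply Hlip|].
  assert (Hpos : 0 < Rabs (x - y)) by (apply Rabs_pos_lt; lra).
  assert (Hle : Rabs (x - y) <= 2 * Rabs M + 1).
  { pose proof (Rabs_triang x (- y)). rewrite Rabs_Ropp in H.
    unfold Rminus. pose proof (Rle_abs M). lra. }
  rewrite Rmult_assoc. apply Rmult_le_compat_l; [exact HC|].
  rewrite <- (Rpower_1 (Rabs (x - y)) Hpos) at 1.
  replace 1 with ((1 - alpha) + alpha) at 1 by ring. rewrite Rpower_plus.
  apply Rmult_le_compat_r; [left; apply exp_pos|].
  apply Rle_Rpower_l; lra.
Qed.

(** * The linearly growing supersolution *)

Lemma japanese_bracket (x : R) :
  1 <= sqrt (1 + x ^ 2) /\ Rabs x <= sqrt (1 + x ^ 2) <= 1 + Rabs x /\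
  sqrt (1 + x ^ 2) * sqrt (1 + x ^ 2) = 1 + x ^ 2.
Proof.
  assert (Hx : 0 <= x ^ 2) by apply pow2_ge_0.
  assert (Ht : sqrt (1 + x ^ 2) * sqrt (1 + x ^ 2) = 1 + x ^ 2) by (apply sqrt_sqrt; lra).
  pose proof (sqrt_pos (1 + x ^ 2)) as H0. pose proof (Rabs_pos x) as Ha.
  rewrite <- (pow2_abs x) in *.
  repeat split; [| | |exact Ht]; apply Rsqr_incr_0_var; unfold Rsqr; nra.
Qed.

Lemma is_derive_japanese_bracket (x : R) :
  is_derive (fun y => sqrt (1 + y ^ 2)) x (x / sqrt (1 + x ^ 2)).
Proof.
  destruct (japanese_bracket x) as [H1 [_ H2]].
  assert (Hp : 0 < 1 + x ^ 2) by nra.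
  auto_derive; [simpl in *; lra|].
  replace (x * (x * 1)) with (x ^ 2) by (simpl; ring). field. lra.
Qed.

Lemma is_derive2_japanese_bracket (x : R) :
  is_derive (fun y => y / sqrt (1 + y ^ 2)) x (/ sqrt (1 + x ^ 2) ^ 3).
Proof.
  destruct (japanese_bracket x) as [H1 [_ H2]].
  apply (is_derive_ext (fun y => y * / sqrt (1 + y ^ 2))); [reflexivity|].
  pose proof (is_derive_japanese_bracket x) as D.
  set (s := fun y => sqrt (1 + y ^ 2)) in *.
  change (is_derive (fun y => y * / s y) x (/ s x ^ 3)).
  assert (Hs : 1 <= s x) by exact H1. assert (Hs2 : s x * s x = 1 + x ^ 2) by exact H2.
  change (is_derive s x (x / s x)) in D.
  clearbody s. auto_derive.
  - split; [eexists; exact D|]. split; [lra|exact I].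
  - rewrite_derive s x D.
    (* The quotient rule produces the numerator [s^2 - x^2], which equals 1. *)
    replace (/ s x ^ 3) with ((s x * s x - x ^ 2) * / s x ^ 3) by (rewrite Hs2; ring).
    field. lra.
Qed.

(** Put [t = sqrt (1 + x^2)]. The slope [A] solves [r * A = L * A + Lf], which balances the growth
    [L * A * t] of the drift term and [Lf * t] of the source. The diffusion term stays bounded,
    since [sigma^2] grows at most like [t^2] while [w2 = A / t^3]. The constant [D] absorbs all
    bounded terms, and the [+ 1] in it makes the inequality strict. *)
Lemma linear_growth_supersolution (b sigma f : R -> R) (L Lf r : R) :
  0 < L ->
  (forall x y, Rabs (b x - b y) + Rabs (sigma x - sigma y) <= L * Rabs (x - y)) ->
  (forall x, 0 <= f x) -> f 0 = 0 -> lipschitz_with Lf f ->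
  L < r ->
  exists w w1 w2 C,
    (forall x, is_derive w x (w1 x)) /\ (forall x, is_derive w1 x (w2 x)) /\
    (forall x, 0 <= w x <= C * (1 + Rabs x)) /\
    (forall x, / 2 * sigma x ^ 2 * w2 x + b x * w1 x + f x < r * w x).
Proof.
  intros HL Hbs Hf0 Hf00 HfL Hr.
  assert (Hf : forall x, 0 <= f x <= Lf * Rabs x).
  { intros x. split; [apply Hf0|]. specialize (HfL x 0).
    rewrite Hf00, !Rminus_0_r, Rabs_pos_eq in HfL by apply Hf0. exact HfL. }
  assert (HLf : 0 <= Lf) by (specialize (Hf 1); rewrite Rabs_R1 in Hf; lra).
  set (A := Lf / (r - L)).
  assert (HA : 0 <= A) by (apply Rdiv_le_0_compat; lra).
  assert (HA' : r * A = L * A + Lf) by (unfold A; field; lra).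
  set (S := Rabs (sigma 0) + L).
  assert (HS : 0 <= S) by (unfold S; pose proof (Rabs_pos (sigma 0)); lra).
  set (D := (A * Rabs (b 0) + / 2 * A * S ^ 2 + 1) / r).
  assert (HD : r * D = A * Rabs (b 0) + / 2 * A * S ^ 2 + 1) by (unfold D; field; lra).
  assert (HD0 : 0 <= D).
  { apply Rdiv_le_0_compat; [|lra]. pose proof (Rabs_pos (b 0)).
    pose proof (Rmult_le_pos _ _ HA H).
    pose proof (Rmult_le_pos _ _ HA (pow2_ge_0 S)). lra. }
  exists (fun x => A * sqrt (1 + x ^ 2) + D), (fun x => A * (x / sqrt (1 + x ^ 2))),
    (fun x => A * / sqrt (1 + x ^ 2) ^ 3), (A + D).
  split; [|split; [|split]].
  - intros x. rewrite <- (Rplus_0_r (A * (x / _))).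
    apply (is_derive_plus (fun y => A * sqrt (1 + y ^ 2)) (fun _ => D)).
    + apply is_derive_scal, is_derive_japanese_bracket.
    + apply (is_derive_const D).
  - intros x. apply (is_derive_scal (fun y => y / sqrt (1 + y ^ 2))),
      is_derive2_japanese_bracket.
  - intros x. destruct (japanese_bracket x) as [H1 [H2 _]].
    pose proof (Rabs_pos x). nra.
  - intros x. destruct (japanese_bracket x) as [H1 [[H2 _] H3]].
    set (t := sqrt (1 + x ^ 2)) in *.
    pose proof (Hbs x 0) as Hg. rewrite Rminus_0_r in Hg.
    pose proof (Rabs_pos (b x - b 0)). pose proof (Rabs_pos (sigma x - sigma 0)).
    assert (Hb : Rabs (b x) <= Rabs (b 0) + L * t).
    { replace (b x) with (b 0 + (b x - b 0)) by ring.
      eapply Rle_trans; [apply Rabs_triang|]. nra. }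
    assert (Hsig : Rabs (sigma x) <= S * t).
    { replace (sigma x) with (sigma 0 + (sigma x - sigma 0)) by ring.
      eapply Rle_trans; [apply Rabs_triang|]. unfold S. pose proof (Rabs_pos (sigma 0)). nra. }
    assert (Hit : 0 < / t) by (apply Rinv_0_lt_compat; lra).
    assert (Hdrift : b x * (A * (x / t)) <= A * (Rabs (b 0) + L * t)).
    { replace (b x * (A * (x / t))) with (A * (b x * (x / t))) by ring.
      apply Rmult_le_compat_l; [exact HA|].
      eapply Rle_trans; [apply Rle_abs|]. rewrite Rabs_mult.
      rewrite <- (Rmult_1_r (Rabs (b 0) + L * t)).
      apply Rmult_le_compat; [apply Rabs_pos|apply Rabs_pos|exact Hb|].
      unfold Rdiv. rewrite Rabs_mult, (Rabs_pos_eq (/ t)) by lra.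
      apply (Rmult_le_reg_r t); [lra|].
      rewrite Rmult_assoc, Rinv_l by lra. lra. }
    assert (Hdiff : / 2 * sigma x ^ 2 * (A * / t ^ 3) <= / 2 * A * S ^ 2).
    { rewrite <- (pow2_abs (sigma x)).
      assert (Hs2 : Rabs (sigma x) ^ 2 <= (S * t) ^ 2).
      { apply pow_incr. split; [apply Rabs_pos|exact Hsig]. }
      assert (Ht3 : (S * t) ^ 2 * / t ^ 3 <= S ^ 2).
      { replace ((S * t) ^ 2 * / t ^ 3) with (S ^ 2 * / t) by (field; lra).
        rewrite <- (Rmult_1_r (S ^ 2)) at 2.
        apply Rmult_le_compat_l; [apply pow2_ge_0|].
        rewrite <- Rinv_1. apply Rinv_le_contravar; lra. }
      assert (0 < / t ^ 3) by (apply Rinv_0_lt_compat, pow_lt; lra).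
      assert (Rabs (sigma x) ^ 2 * / t ^ 3 <= S ^ 2).
      { eapply Rle_trans; [|exact Ht3]. apply Rmult_le_compat_r; lra. }
      replace (/ 2 * Rabs (sigma x) ^ 2 * (A * / t ^ 3))
        with (/ 2 * A * (Rabs (sigma x) ^ 2 * / t ^ 3)) by ring.
      apply Rmult_le_compat_l; lra. }
    specialize (Hf x). assert (Lf * Rabs x <= Lf * t) by (apply Rmult_le_compat_l; lra).
    replace (r * (A * t + D)) with (r * A * t + r * D) by ring.
    rewrite HA', HD. lra.
Qed.

(** * Application to the given coefficients *)

Lemma lipschitz_continuous (C : R) (g : R -> R) (x : R) :
  lipschitz_with C g -> continuous g x.
Proof.
  intros Hg. apply (proj2 (filterlim_locally _ _)). intros [eps Heps].
  pose proof (Rabs_pos C) as HC.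
  exists (mkposreal (eps / (Rabs C + 1)) ltac:(apply Rdiv_lt_0_compat; lra)).
  intros y Hy. change (Rabs (y - x) < eps / (Rabs C + 1)) in Hy.
  change (Rabs (g y - g x) < eps).
  eapply Rle_lt_trans; [apply Hg|].
  apply (Rmult_lt_compat_l (Rabs C + 1)) in Hy; [|lra].
  replace ((Rabs C + 1) * (eps / (Rabs C + 1))) with eps in Hy by (field; lra).
  pose proof (Rabs_pos (y - x)). pose proof (Rle_abs C). nra.
Qed.

Theorem theoremA1
  (b sigma f l : R -> R) (L sigma0 Lf K Ll r : R)
  (* standing assumptions *)
  (hL : 0 < L)
  (hbs : forall x y, Rabs (b x - b y) + Rabs (sigma x - sigma y) <= L * Rabs (x - y))
  (hs0 : 0 < sigma0) (hsig : forall x, sigma0 <= Rabs (sigma x))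
  (hf0 : forall x, 0 <= f x) (hf00 : f 0 = 0) (hfL : lipschitz_with Lf f)
  (hK : 0 < K) (hl0 : l 0 = K) (hlinf : forall x, K <= l x)
  (hlsub : forall x y, l (x + y) + K <= l x + l y)
  (hlcoer : coercive l) (hlL : lipschitz_with Ll l)
  (hr1 : 0 < r - (L + / 2 * L ^ 2)) (hr2 : r - (L + / 2 * L ^ 2) < Lf / Ll)
  (* statement-specific data *)
  (lambda : R) (hlam : 0 < lambda)
  (phi : R -> R) (lphi : R) (hphiL : lipschitz phi)
  (hlphi : 0 <= lphi) (hphi : forall x, lphi <= phi x) :
  exists V : R -> R,
    solves_eq b sigma f phi r lambda V /\
    (forall alpha, 0 < alpha < 1 -> C2alpha_loc alpha V) /\
    linear_growth_at_infinity V.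
Proof.
  clear K l Ll hK hl0 hlinf hlsub hlcoer hlL hr2.
  assert (HLr : L < r) by (pose proof (pow2_ge_0 L); lra).
  assert (Hbl : lipschitz_with L b).
  { intros x y. pose proof (hbs x y). pose proof (Rabs_pos (sigma x - sigma y)). lra. }
  assert (Hsl : lipschitz_with L sigma).
  { intros x y. pose proof (hbs x y). pose proof (Rabs_pos (b x - b y)). lra. }
  destruct hphiL as [Cphi Hphil].
  assert (Hs2 : forall x, sigma0 ^ 2 <= sigma x ^ 2).
  { intros x. rewrite <- (pow2_abs (sigma x)). apply pow_incr. split; [lra|apply hsig]. }
  assert (Hs02 : 0 < sigma0 ^ 2) by now apply pow_lt.
  assert (Hq : forall x, 0 < / sigma x ^ 2).
  { intros x. apply Rinv_0_lt_compat. specialize (Hs2 x). lra. }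
  destruct (linear_growth_supersolution b sigma f L Lf r hL hbs hf0 hf00 hfL HLr)
    as [w [w1 [w2 [C [Dw [Dw1 [Hw Hsup]]]]]]].
  (* With this choice [r * c > lambda], and the exponential term at [- c] is at most [lambda]
     because [phi >= 0]; so [- c] is a strict subsolution. *)
  set (c := lambda / r + 1).
  assert (Hc : 0 < c) by (unfold c; pose proof (Rdiv_lt_0_compat lambda r hlam); lra).
  assert (Hrc : lambda < r * c) by (unfold c; field_simplify; lra).
  (* Solving the equation for the second derivative gives [V'' = g x V - beta x * V']. *)
  set (beta := fun x => 2 * (b x * / sigma x ^ 2)).
  set (g := fun x v => 2 * ((r * v - f x + lambda * exp (- (phi x - v) / lambda))
                            * / sigma x ^ 2)).
  (* For [- c <= v <= w x], the first three terms bound the size of the numerator of [g]. The last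
     two bound its Lipschitz constant in [v]: the factor [lambda] cancels the [1 / lambda] from
     differentiating the exponential. *)
  set (kap := fun x => 2 * ((r * (c + w x) + f x + lambda * exp (w x * / lambda)
                       + r + exp (w x * / lambda)) * / sigma x ^ 2)).
  assert (Hcs : forall x, continuous (fun y => / sigma y ^ 2) x).
  { intros x. apply continuous_Rinv_comp; [|specialize (Hs2 x); lra].
    apply (continuous_ext (fun y => sigma y * sigma y)); [intros; simpl; ring|].
    apply continuous_Rmult; exact (lipschitz_continuous L sigma x Hsl). }
  assert (Hcf : forall x, continuous f x) by (intros x; exact (lipschitz_continuous _ _ x hfL)).
  assert (Hcb : forall x, continuous b x) by (intros x; exact (lipschitz_continuous _ _ x Hbl)).
  assert (Hcphi : forall x, continuous phi x)
    by (intros x; exact (lipschitz_continuous _ _ x Hphil)).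
  assert (Hcw : forall x, continuous w x)
    by (intros x; exact (is_derive_continuous _ _ _ (Dw x))).
  assert (Hcbeta : forall x, continuous beta x) by (intros x; unfold beta; continuity_R).
  assert (Hcg : forall u, (forall x, continuous u x) ->
            forall x, continuous (fun z => g z (u z)) x)
    by (intros u Hu x; unfold g, Rdiv; continuity_R).
  assert (Hexp : forall x v, v <= w x -> - (phi x - v) / lambda <= w x * / lambda).
  { intros x v Hv. apply Rmult_le_compat_r; [left; now apply Rinv_0_lt_compat|].
    specialize (hphi x). lra. }
  assert (Hexp' : forall x v, v <= w x ->
            0 < exp (- (phi x - v) / lambda) <= exp (w x * / lambda)).
  { intros x v Hv. split; [apply exp_pos|].
    destruct (Hexp x v Hv) as [H| ->]; [left; now apply exp_increasing|apply Rle_refl]. }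
  destruct (solution_between_barriers beta w w1 w2 kap g (- c)) as [V [V1 [DV [DV1 HV]]]];
    auto.
  - intros x. specialize (Hw x). lra.
  - intros x. unfold kap. continuity_R.
  - intros x v [H1 H2]. unfold g, kap. specialize (Hq x). specialize (hf0 x).
    pose proof (Hexp' x v H2).
    rewrite 2!Rabs_mult, (Rabs_pos_eq 2), (Rabs_pos_eq (/ _)) by lra.
    apply Rmult_le_compat_l; [lra|]. apply Rmult_le_compat_r; [lra|].
    specialize (Hw x).
    assert (lambda * exp (- (phi x - v) / lambda) <= lambda * exp (w x * / lambda))
      by (apply Rmult_le_compat_l; lra).
    assert (0 < lambda * exp (- (phi x - v) / lambda)) by (apply Rmult_lt_0_compat; lra).
    apply Rabs_le. nra.
  - intros x u v [Hu1 Hu2] [Hv1 Hv2]. unfold g, kap. specialize (Hq x). specialize (hf0 x).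
    pose proof (exp_lipschitz_below _ _ _ (Hexp x u Hu2) (Hexp x v Hv2)) as He.
    replace (- (phi x - u) / lambda - - (phi x - v) / lambda)
      with ((u - v) * / lambda) in He by (field; lra).
    rewrite Rabs_mult, (Rabs_pos_eq (/ lambda)) in He
      by (left; now apply Rinv_0_lt_compat).
    set (e1 := exp (- (phi x - u) / lambda)) in *.
    set (e2 := exp (- (phi x - v) / lambda)) in *.
    set (e := exp (w x * / lambda)) in *.
    assert (He0 : 0 < e) by apply exp_pos.
    replace (2 * ((r * u - f x + lambda * e1) * / sigma x ^ 2)
             - 2 * ((r * v - f x + lambda * e2) * / sigma x ^ 2))
      with (2 * ((r * (u - v) + lambda * (e1 - e2)) * / sigma x ^ 2)) by ring.
    rewrite 2!Rabs_mult, (Rabs_pos_eq 2), (Rabs_pos_eq (/ sigma x ^ 2)) by lra.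
    rewrite (Rmult_assoc 2). apply Rmult_le_compat_l; [lra|].
    rewrite (Rmult_assoc _ (/ sigma x ^ 2)), (Rmult_comm (/ sigma x ^ 2)), <- Rmult_assoc.
    apply Rmult_le_compat_r; [lra|].
    eapply Rle_trans; [apply Rabs_triang|].
    rewrite 2!Rabs_mult, (Rabs_pos_eq r), (Rabs_pos_eq lambda) by lra.
    apply (Rmult_le_compat_l lambda) in He; [|lra].
    replace (lambda * (e * (Rabs (u - v) * / lambda))) with (e * Rabs (u - v)) in He
      by (field; lra).
    specialize (Hw x). pose proof (Rabs_pos (u - v)).
    assert (0 <= r * (c + w x) + f x + lambda * e).
    { pose proof (Rmult_le_pos r (c + w x) ltac:(lra) ltac:(lra)).
      pose proof (Rmult_lt_0_compat _ _ hlam He0). lra. }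
    nra.
  - intros x. unfold g. specialize (Hq x).
    assert (He : exp (- (phi x - - c) / lambda) <= 1).
    { rewrite <- exp_0.
      assert (Hlt : - (phi x - - c) / lambda < 0).
      { apply (Rmult_lt_reg_r lambda); [exact hlam|].
        replace (- (phi x - - c) / lambda * lambda) with (- (phi x + c)) by (field; lra).
        specialize (hphi x). lra. }
      left. now apply exp_increasing. }
    specialize (hf0 x).
    assert (Hneg : r * - c - f x + lambda * exp (- (phi x - - c) / lambda) < 0).
    { apply (Rmult_le_compat_l lambda) in He; lra. }
    nra.
  (* Multiplication by [sigma^2 / 2] brings back the linear inequality for [w]; the exponential term
     is positive and only helps. *)
  - intros x. unfold g, beta. specialize (Hq x). specialize (Hsup x). specialize (Hs2 x).
    pose proof (exp_pos (- (phi x - w x) / lambda)) as He.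
    pose proof (Rmult_lt_0_compat _ _ hlam He).
    apply (Rmult_lt_reg_r (/ 2 * sigma x ^ 2)); [lra|].
    replace ((w2 x + 2 * (b x * / sigma x ^ 2) * w1 x) * (/ 2 * sigma x ^ 2))
      with (/ 2 * sigma x ^ 2 * w2 x + b x * w1 x) by (field; intros E; rewrite E in Hs2; lra).
    match goal with |- _ < 2 * (?e * _) * _ =>
      replace (2 * (e * / sigma x ^ 2) * (/ 2 * sigma x ^ 2)) with e
        by (field; intros E; rewrite E in Hs2; lra) end.
    lra.
  - assert (HV1c : forall x, continuous V1 x)
      by (intros x; exact (is_derive_continuous _ _ _ (DV1 x))).
    assert (HVc : forall x, continuous V x)
      by (intros x; exact (is_derive_continuous _ _ _ (DV x))).
    exists V. split; [|split].
    + exists V1, (fun x => g x (V x) - beta x * V1 x). split; [now split|].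
      intros x. unfold g, beta. specialize (Hs2 x). field.
      intros E; rewrite E in Hs2; lra.
    + intros alpha Ha. exists V1, (fun x => g x (V x) - beta x * V1 x).
      split; [now split|]. apply locally_lipschitz_holder; [lra|].
      assert (Hlq : locally_lipschitz (fun x => / sigma x ^ 2)).
      { apply (locally_lipschitz_inv (fun x => sigma x ^ 2) (sigma0 ^ 2)); [lra| |].
        - intros x. rewrite Rabs_pos_eq by apply pow2_ge_0. apply Hs2.
        - assert (Hls : locally_lipschitz sigma) by exact (locally_lipschitz_global _ _ Hsl).
          apply (locally_lipschitz_mult sigma (fun x => sigma x * 1)); [exact Hls|].
          apply locally_lipschitz_mult; [exact Hls|apply locally_lipschitz_const]. }
      assert (HlV : locally_lipschitz V)
        by exact (locally_lipschitz_C1 V V1 DV HV1c).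
      (* The formula for the second derivative is already known to be continuous, so [V1] is itself
         of class C^1. *)
      assert (HlV1 : locally_lipschitz V1).
      { apply (locally_lipschitz_C1 V1 (fun x => g x (V x) - beta x * V1 x) DV1).
        intros x. continuity_R. }
      pose proof (locally_lipschitz_global _ _ hfL) as Hlf.
      pose proof (locally_lipschitz_global _ _ Hbl) as Hlb.
      pose proof (locally_lipschitz_global _ _ Hphil) as Hlphi.
      unfold g, beta, Rdiv.
      repeat match goal with
      | |- locally_lipschitz (fun _ => _ - _) => apply locally_lipschitz_minus
      | |- locally_lipschitz (fun _ => _ + _) => apply locally_lipschitz_plus
      | |- locally_lipschitz (fun _ => _ * _) => apply locally_lipschitz_mult
      | |- locally_lipschitz (fun _ => - _) => apply locally_lipschitz_opp
      | |- locally_lipschitz (fun _ => exp _) => apply locally_lipschitz_exp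
      | |- locally_lipschitz (fun _ => ?k) => apply locally_lipschitz_const
      end; assumption.
    (* For [|x| >= 1] one has [c <= c * |x|] and [1 + |x| <= 2 * |x|], which turns both barriers
       into multiples of [|x|]. *)
    + exists (c + 2 * Rabs C), 1. intros x Hx.
      specialize (HV x). specialize (Hw x).
      assert (HCx : C * (1 + Rabs x) <= Rabs C * (2 * Rabs x)).
      { pose proof (Rle_abs C). pose proof (Rabs_pos C). nra. }
      assert (HVx : Rabs (V x) <= (c + 2 * Rabs C) * Rabs x).
      { pose proof (Rabs_pos C). apply Rabs_le. nra. }
      unfold Rdiv. rewrite Rabs_mult, Rabs_inv.
      apply (Rmult_le_reg_r (Rabs x)); [lra|].
      rewrite Rmult_assoc, Rinv_l by lra. lra.
Qed.
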